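(* Let $f,h:[a,b]\to\mathbb{R}$ be $g$-continuous on $[a,b]$. If $f$ and $h$ are $g$-differentiable on $[a,b]$ and $|f'_g(t)|\le h'_g(t)$ for all $t\in[a,b]$, then $$|f(s)-f(t)|\le|h(s)-h(t)|,\qquad s,t\in[a,b].$$
   Context: Let $a<b$ be real numbers and let $g:\mathbb{R}\to\mathbb{R}$ be non-decreasing and left-continuous (a ''derivator''). Put $\Delta g(t)=g(t^+)-g(t)$, $D_g=\{t\in\mathbb{R}:\Delta g(t)>0\}$, and $C_g=\{t\in\mathbb{R}: g \text{ is constant on } (t-\varepsilon,t+\varepsilon)\text{ for some }\varepsilon>0\}$. The set $C_g$ is open; write $C_g=\bigcup_n (a_n,b_n)$ with $(a_n,b_n)$ its (pairwise disjoint) connected components. Put $N_g^-=\{a_n\}_n\setminus D_g$, $N_g^+=\{b_n\}_n\setminus D_g$. Standing assumption: $a\notin N_g^-$ and $b\notin N_g^+\cup D_g\cup C_g$. $g$-derivative: for $f:[a,b]\to\mathbb{R}$ and $t\in[a,b]$, $f'_g(t)=\lim_{s\to t}\frac{f(s)-f(t)}{g(s)-g(t)}$ if $t\notin D_g\cup C_g$; $f'_g(t)=\lim_{s\to t^+}\frac{f(s)-f(t)}{g(s)-g(t)}$ if $t\in D_g$; $f'_g(t)=\lim_{s\to b_n^+}\frac{f(s)-f(b_n)}{g(s)-g(b_n)}$ if $t\in(a_n,b_n)\subset C_g$; provided the limit exists (and is finite). Limits are taken over those $s\in[a,b]$ for which the denominator is nonzero. $f$ is $g$-differentiable on $[a,b]$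 if $f'_g(t)$ exists for every $t\in[a,b]$. $g$-continuity: $f$ is $g$-continuous at $t\in[a,b]$ if for every $\varepsilon>0$ there is $\delta>0$ such that $|f(t)-f(s)|<\varepsilon$ for all $s\in[a,b]$ with $|g(t)-g(s)|<\delta$; $g$-continuous on $[a,b]$ means at every point of $[a,b]$. *)

(* Defs.v *)
From HB Require Import structures.
From mathcomp Require Import all_boot all_order all_algebra.
From mathcomp Require Import all_classical all_reals all_analysis.

Set Implicit Arguments.
Unset Strict Implicit.
Unset Printing Implicit Defensive.

Import Order.TTheory GRing.Theory Num.Theory.
Import numFieldNormedType.Exports.

Local Open Scope classical_set_scope.
Local Open Scope ring_scope.

(* Functions on [a, b] are represented by total functions R -> R; every
   notion below with parameters a b only reads their values on `[a, b]. *)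

Definition derivator (R : realType) (g : R -> R) : Prop :=
  {homo g : x y / x <= y} /\ (forall t, g x @[x --> t^'-] --> g t).

Definition jump (R : realType) (g : R -> R) (t : R) : R :=
  lim (g x @[x --> t^'+]) - g t.

Definition Dset (R : realType) (g : R -> R) : set R :=
  [set t | 0 < jump g t].

Definition Cset (R : realType) (g : R -> R) : set R :=
  [set t | exists2 e : R, 0 < e &
     forall x y, x \in `]t - e, t + e[ -> y \in `]t - e, t + e[ -> g x = g y].

(* A component of Cset g may be unbounded; only its finite endpoints are
   points of R, hence the has_lbound/has_ubound conditions: inf and sup are 0
   by convention on unbounded sets. *)
Definition Nminus (R : realType) (g : R -> R) : set R :=
  [set x | exists2 t, Cset g t &
     has_lbound (connected_component (Cset g) t) /\
     x = inf (connected_component (Cset g) t)] `\` Dset g.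

Definition Nplus (R : realType) (g : R -> R) : set R :=
  [set x | exists2 t, Cset g t &
     has_ubound (connected_component (Cset g) t) /\
     x = sup (connected_component (Cset g) t)] `\` Dset g.

Definition standing (R : realType) (a b : R) (g : R -> R) : Prop :=
  ~ Nminus g a /\ ~ (Nplus g `|` Dset g `|` Cset g) b.

(* Base point of the difference quotient at t: b_n if t lies in the component
   (a_n, b_n) of Cset g, and t otherwise.  If t <= b and b is not in Cset g,
   then b_n <= b, so that the supremum is a genuine one. *)
Definition gbase (R : realType) (g : R -> R) (t : R) : R :=
  if t \in Cset g then sup (connected_component (Cset g) t) else t.

(* If a < b, g is a derivator and standing a b g holds, then this filter is
   proper for all t in [a, b]. *)
Definition gnbhs (R : realType) (a b : R) (g : R -> R) (t : R) :
    set_system R :=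
  within [set s | s \in `[a, b] /\ g s - g (gbase g t) != 0]
    (if (t \in Dset g) || (t \in Cset g) then (gbase g t)^'+
     else (gbase g t)^').

Definition gquot (R : realType) (g f : R -> R) (t s : R) : R :=
  (f s - f (gbase g t)) / (g s - g (gbase g t)).

Definition gderivable (R : realType) (a b : R) (g f : R -> R) (t : R) : Prop :=
  cvg (gquot g f t s @[s --> gnbhs a b g t]).

(* Meaningful only when gderivable a b g f t holds. *)
Definition gderive (R : realType) (a b : R) (g f : R -> R) (t : R) : R :=
  lim (gquot g f t s @[s --> gnbhs a b g t]).

Definition gdifferentiable (R : realType) (a b : R) (g f : R -> R) : Prop :=
  forall t, t \in `[a, b] -> gderivable a b g f t.

Definition gcontinuous_at (R : realType) (a b : R) (g f : R -> R) (t : R) :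
    Prop :=
  forall e : R, 0 < e -> exists2 d : R, 0 < d &
    forall s, s \in `[a, b] -> `|g t - g s| < d -> `|f t - f s| < e.

Definition gcontinuous (R : realType) (a b : R) (g f : R -> R) : Prop :=
  forall t, t \in `[a, b] -> gcontinuous_at a b g f t.

(* Main.v *)
Require Import Defs.
From HB Require Import structures.
From mathcomp Require Import all_boot all_order all_algebra.
From mathcomp Require Import all_classical all_reals all_analysis.
From mathcomp Require Import lra.
Import Order.TTheory GRing.Theory Num.Theory.
Import numFieldNormedType.Exports.
Local Open Scope classical_set_scope.
Local Open Scope ring_scope.

(** The theorem is two monotonicity statements: [|f s - f t| <= h t - h s] for
    [s <= t] says that [h - f] and [h + f] are non-decreasing on [a, b], and
    their g-derivatives are nonnegative because [|f'_g| <= h'_g].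

    So let [u] be g-continuous with nonnegative g-derivative.  For [e > 0] the
    perturbation [u + e g] has g-derivative at least [e], which turns the sign
    of a limit into the sign of a difference: [u + e g] takes values at least
    [u t + e g t] immediately to the right of every [t]
    ([gderive_ge0_near_right]).  It is also left-continuous, since [g] is and
    [u] is g-continuous ([gcontinuous_cvg_left]).  These two one-sided local
    properties imply monotonicity by a supremum argument
    ([le_of_near_right]), and [e] tends to 0 ([gderive_ge0_homo]).

    The limit at [t] ignores the [x] with [g x = g t], and inside a component
    of [Cset g] it is taken at another point.  There it is g-continuity that
    controls [u], forcing [u x = u t] whenever [g x = g t]
    ([gcontinuous_eq]). *)

(** Continuous induction: the supremum [c] of the points up to which [v] stays
    above [v s] inherits [v s <= v c] from the left, and the growth on the
    right of [c] would carry the inequality beyond [c] if [c < t]. *)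
Lemma le_of_near_right {R : realType} {v : R -> R} {s t : R} :
  s <= t ->
  (forall x, s < x <= t -> v y @[y --> x^'-] --> v x) ->
  (forall x, s <= x < t -> \forall y \near x^'+, v x <= v y) ->
  v s <= v t.
Proof.
move=> st vleft vright.
pose A := [set x | s <= x <= t /\ forall y, s <= y <= x -> v s <= v y].
have As : A s.
  split; first by rewrite lexx.
  by move=> y /andP[sy ys]; have -> : y = s by apply/le_anti/andP.
have At : ubound A t by move=> x [/andP[]].
have hsA : has_sup A by split; [exists s | exists t].
set c := sup A.
have sc : s <= c by apply: ub_le_sup => //; exists t.
have ct : c <= t by apply: ge_sup => //; exists s.
have vltc y : s <= y -> y < c -> v s <= v y.
  move=> sy yc; have [|x [_ Ax] yx] := @sup_adherent _ A (c - y) _ hsA.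
    by rewrite subr_gt0.
  by apply: Ax; rewrite sy ltW//; move: yx; rewrite -/c; lra.
have vc : v s <= v c.
  move: (sc); rewrite le_eqVlt => /predU1P[<- //|sc'].
  have vcc : v y @[y --> c^'-] --> v c by apply: vleft; rewrite sc'.
  apply: (cvgr_to_ge vcc).
  near=> y; apply: vltc.
    by near: y; exact: nbhs_left_ge.
  by near: y; exact: nbhs_left_lt.
move: (ct); rewrite le_eqVlt => /predU1P[<- //|ct'].
have [|e /= e0 He] := vright c; first by rewrite sc.
pose z := Num.min t (c + e / 2).
have cz : c < z by rewrite /z lt_min ct' /=; lra.
have zt : z <= t by rewrite /z ge_min lexx.
have ze : z <= c + e / 2 by rewrite /z ge_min lexx orbT.
have Az : A z.
  split; first by rewrite zt (le_trans sc (ltW cz)).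
  move=> y /andP[sy yz]; case: (ltgtP y c) => [|cy|->//]; first exact: vltc.
  apply: (le_trans vc); apply: He => //=.
  by rewrite ltr0_norm; lra.
have : z <= c by apply: ub_le_sup => //; exists t.
by rewrite leNgt cz.
Unshelve. all: by end_near. Qed.

#[local] Instance gnbhs_filter {R : realType} (a b : R) (g : R -> R) (t : R) :
  Filter (gnbhs a b g t).
Proof. by apply: within_filter; case: ifP => _; exact: _. Qed.

Lemma gcontinuous_eq {R : realType} {a b : R} {g u : R -> R} {s t : R} :
  gcontinuous a b g u -> s \in `[a, b] -> t \in `[a, b] ->
  g s = g t -> u s = u t.
Proof.
move=> uc sab tab gst; apply/eqP; rewrite -subr_eq0 -normr_le0.
apply/ler_addgt0Pl => e e0; rewrite addr0 ltW//.
have [d d0] := uc s sab e e0.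
by apply => //; rewrite gst subrr normr0.
Qed.

Lemma gcontinuous_cvg_left {R : realType} {a b : R} {g u : R -> R} {t : R} :
  derivator g -> gcontinuous a b g u -> a < t <= b ->
  u x @[x --> t^'-] --> u t.
Proof.
move=> [_ gl] uc /andP[alt tb]; apply/cvgrPdist_lt => e e0.
have [|d d0 ud] := uc t _ e e0; first by rewrite in_itv/= ltW.
have /cvgrPdist_lt /(_ d d0) gd := gl t.
near=> x; apply: ud; last by near: x; exact: gd.
rewrite in_itv/=; apply/andP; split.
  by near: x; exact: nbhs_left_ge.
by apply: le_trans tb; near: x; exact: nbhs_left_le.
Unshelve. all: by end_near. Qed.

(** At a point of [Cset g], as at a nearby [x] with [g x = g t], the function
    [u] does not move.  Elsewhere the base point of the quotient is [t], and a
    quotient above [- e] gives the bound. *)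
Lemma gderive_ge0_near_right {R : realType} {a b : R} {g u : R -> R}
    {t l e : R} :
  {homo g : x y / x <= y} -> gcontinuous a b g u -> a <= t < b ->
  gquot g u t s @[s --> gnbhs a b g t] --> l -> 0 <= l -> 0 < e ->
  \forall x \near t^'+, u t + e * g t <= u x + e * g x.
Proof.
move=> gm uc /andP[at_ tb] ul l0 e0.
have tab : t \in `[a, b] by rewrite in_itv/= at_ ltW.
have xab : \forall x \near t^'+, x \in `[a, b].
  near=> x; rewrite in_itv/=; apply/andP; split.
    by apply: le_trans at_ _; near: x; exact: nbhs_right_ge.
  by near: x; exact: nbhs_right_le.
have flat x : x \in `[a, b] -> g x = g t -> u t + e * g t <= u x + e * g x.
  by move=> xI gxt; rewrite (gcontinuous_eq uc xI tab gxt) gxt.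
have [tC|tC] := boolP (t \in Cset g).
  have [d d0 gd] : Cset g t by exact/set_mem.
  near=> x; apply: flat; first by near: x; exact: xab.
  apply: gd; rewrite in_itv/=; apply/andP; split; try lra.
    have : t < x by near: x; exact: nbhs_right_gt.
    by lra.
  by near: x; apply: nbhs_right_lt; lra.
have base : gbase g t = t by rewrite /gbase (negbTE tC).
have quotR : \forall x \near t^'+,
    x \in `[a, b] -> g x != g t -> - e < (u x - u t) / (g x - g t).
  have : \forall x \near gnbhs a b g t, - e < gquot g u t x.
    by apply: (cvgr_gt l) => //; lra.
  rewrite /gnbhs /gquot base (negbTE tC) orbF => Q.
  have {}Q : \forall x \near t^'+,
      (x \in `[a, b] /\ g x - g t != 0) -> - e < (u x - u t) / (g x - g t).
    move: Q; case: ifP => _ //.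
    rewrite /dnbhs /at_right !near_withinE; apply: filterS => x Q tx.
    by apply: Q; rewrite gt_eqF.
  apply: filterS Q => x Q xI gxt; apply: Q; split => //.
  by rewrite subr_eq0.
near=> x.
have xI : x \in `[a, b] by near: x; exact: xab.
have [gxt|gxt] := eqVneq (g x) (g t); first exact: flat.
have tx : t <= x by near: x; exact: nbhs_right_ge.
have gpos : 0 < g x - g t by rewrite subr_gt0 lt_neqAle eq_sym gxt gm.
have /(_ xI gxt) : x \in `[a, b] -> g x != g t ->
    - e < (u x - u t) / (g x - g t) by near: x; exact: quotR.
rewrite ltr_pdivlMr// mulrBr; lra.
Unshelve. all: by end_near. Qed.

Lemma gderive_ge0_homo {R : realType} {a b : R} {g u : R -> R} :
  derivator g -> gcontinuous a b g u ->
  (forall t, t \in `[a, b] ->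
    exists2 l, gquot g u t s @[s --> gnbhs a b g t] --> l & 0 <= l) ->
  forall s t, s \in `[a, b] -> t \in `[a, b] -> s <= t -> u s <= u t.
Proof.
move=> dg uc ud s t; rewrite !in_itv/= => /andP[as_ sb] /andP[at_ tb] st.
have [gm gl] := dg.
have key e : 0 < e -> u s + e * g s <= u t + e * g t.
  move=> e0; apply: (@le_of_near_right _ (fun x => u x + e * g x)) => //.
    move=> x /andP[sx xt]; apply: cvgD; last by apply: cvgMr; exact: gl.
    apply: gcontinuous_cvg_left dg uc _.
    by rewrite (le_lt_trans as_ sx) (le_trans xt tb).
  move=> x /andP[sx xt].
  have ax : a <= x by exact: le_trans as_ sx.
  have xb : x < b by exact: lt_le_trans xt tb.
  have [|l ul l0] := ud x; first by rewrite in_itv/= ax ltW.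
  by apply: gderive_ge0_near_right gm uc _ ul l0 e0; rewrite ax.
have gst : 0 <= g t - g s by rewrite subr_ge0; exact: gm.
apply/ler_addgt0Pl => e e0.
(* The denominator is increased by 1 because [g t = g s] is possible. *)
have d0 : 0 < g t - g s + 1 by lra.
have := key (e / (g t - g s + 1)) (divr_gt0 e0 d0).
have : e / (g t - g s + 1) * (g t - g s + 1) = e by rewrite divfK// gt_eqF.
have := divr_gt0 e0 d0.
set q := e / _; nra.
Qed.

Lemma gcontinuousD {R : realType} {a b : R} {g u v : R -> R} :
  gcontinuous a b g u -> gcontinuous a b g v -> gcontinuous a b g (u \+ v).
Proof.
move=> uc vc t tab e e0; have e2 : 0 < e / 2 by lra.
have [d d0 ud] := uc t tab _ e2; have [d' d'0 vd] := vc t tab _ e2.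
exists (Num.min d d'); first by rewrite lt_min d0.
move=> s sab; rewrite lt_min => /andP[/(ud s sab) us /(vd s sab) vs] /=.
rewrite opprD addrACA (le_lt_trans (ler_normD _ _))//; lra.
Qed.

Lemma gcontinuousN {R : realType} {a b : R} {g u : R -> R} :
  gcontinuous a b g u -> gcontinuous a b g (\- u).
Proof.
move=> uc t tab e e0; have [d d0 ud] := uc t tab e e0.
by exists d => // s sab /(ud s sab); rewrite /= -opprD normrN.
Qed.

Theorem corollary3p7 (R : realType) (a b : R) (g f h : R -> R)
  (hab : a < b) (hg : derivator g) (hstd : standing a b g)
  (hfc : gcontinuous a b g f) (hhc : gcontinuous a b g h)
  (hfd : gdifferentiable a b g f) (hhd : gdifferentiable a b g h)
  (hle : forall t, t \in `[a, b] ->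
     `|gderive a b g f t| <= gderive a b g h t) :
  forall s t, s \in `[a, b] -> t \in `[a, b] ->
    `|f s - f t| <= `|h s - h t|.
Proof.
have addP s t : s \in `[a, b] -> t \in `[a, b] -> s <= t ->
    (h \+ f) s <= (h \+ f) t.
  apply: gderive_ge0_homo hg (gcontinuousD hhc hfc) _ s t => t tab.
  exists (gderive a b g h t + gderive a b g f t); last first.
    by have := hle t tab; rewrite ler_norml => /andP[]; lra.
  have -> : gquot g (h \+ f) t = gquot g h t \+ gquot g f t.
    by apply/funext => s; rewrite /gquot /= opprD addrACA mulrDl.
  by apply: cvgD; [exact: hhd | exact: hfd].
have subP s t : s \in `[a, b] -> t \in `[a, b] -> s <= t ->
    (h \- f) s <= (h \- f) t.
  apply: gderive_ge0_homo hg
    (gcontinuousD hhc (gcontinuousN hfc)) _ s t => t tab.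
  exists (gderive a b g h t - gderive a b g f t); last first.
    by have := hle t tab; rewrite ler_norml => /andP[]; lra.
  have -> : gquot g (h \- f) t = gquot g h t \- gquot g f t.
    apply/funext => s.
    by rewrite /gquot /= -mulrBl; congr (_ / _); lra.
  by apply: cvgB; [exact: hhd | exact: hfd].
move=> s t sab tab; wlog st : s t sab tab / s <= t => [hwlog|].
  have [st|/ltW ts] := leP s t; first exact: hwlog.
  by rewrite (distrC (f s)) (distrC (h s)); exact: hwlog.
have := addP s t sab tab st; have := subP s t sab tab st => /= H1 H2.
rewrite (distrC (h s)) (ger0_norm (x := h t - h s)); last lra.
by rewrite ler_norml; apply/andP; split; lra.
Qed.
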